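(* Let $D\subseteq\mathbb{F}_q$ have cardinality $n$, let $1\le k\le n$ and $\ell\ge1$ be integers with $k+\ell\le n-1$, let $f\in\mathbb{F}_q[x]$ be monic of degree $k+\ell$, and let $\varepsilon=\langle f\rangle$. Let $Z$ denote the Hamming distance between the received word represented by $f$ and a uniformly random codeword $g$ of $\mathcal{RS}_{n,k}$ (each codeword being chosen with probability $q^{-k}$), and let $Y=n-Z$. Then for every integer $m\ge 0$, $$\mathbb{E}\left(Y^{\underline m}\right)=\llbracket m\le k\rrbracket\, n^{\underline m}q^{-m}+\llbracket k+1\le m\le k+\ell\rrbracket\, q^{-k}\,m!\,W_m(\varepsilon).$$
   Context: $\mathbb{F}_q$ is the finite field with $q$ elements. The Reed-Solomon code $\mathcal{RS}_{n,k}$ with evaluation set $D$ is the set of words $(g(x))_{x\in D}\in\mathbb{F}_q^n$, where $g$ runs over all polynomials in $\mathbb{F}_q[x]$ of degree at most $k-1$ (including $0$); the word represented by $f$ is $(f(x))_{x\in D}$. The Hamming distance of two words is the number of coordinates in which they differ. Notation: $n^{\underline m}=n(n-1)\cdots(n-m+1)$ is the falling factorial, and $\llbracket P\rrbracket$ is $1$ if $P$ is true and $0$ otherwise. Equivalence classes: for the fixed $\ell$, two monic polynomials $f,g\in\mathbb{F}_q[x]$ are equivalent if $[x^{\deg f-j}]f=[x^{\deg g-j}]g$ for $1\le j\le\ell$, where $[x^i]f$ is the coefficient of $x^i$ (equal to $0$ for $i<0$). $\langle f\rangle$ is the class of $f$, and $\mathcal{E}$ is the set of all classes, an abelian group of order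 $q^\ell$ under $\langle f\rangle\langle g\rangle=\langle fg\rangle$. For $0\le i\le \ell-1$ let $\mathcal{E}_i=\{\langle h\rangle: h\in\mathbb{F}_q[x]\text{ monic of degree } i\}$ (this set has $q^i$ elements). For $k+1\le j\le k+\ell$, $W_j(\varepsilon)$ is the number of pairs $(\eta,S)$ with $\eta\in\mathcal{E}_{k+\ell-j}$ and $S$ a $j$-element subset of $D$ such that $\eta\prod_{\alpha\in S}\langle x-\alpha\rangle=\varepsilon$. *)

(* Defs.v *)
From HB Require Import structures.
From mathcomp Require Import all_boot all_order all_fingroup all_algebra.
From mathcomp Require Import boolp zify.

Set Implicit Arguments.
Unset Strict Implicit.
Unset Printing Implicit Defensive.

Import GRing.Theory.
Local Open Scope ring_scope.
Local Open Scope quotient_scope.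

(* The coefficient of x^(deg f - j), read as 0 when deg f < j (the natural
   number subtraction alone would return the constant coefficient). *)
Definition top_coef (F : finFieldType) (f : {poly F}) (j : nat) : F :=
  if (j <= (size f).-1)%N then f`_((size f).-1 - j) else 0.

Record monic_poly (F : finFieldType) := MonicPoly {
  monic_val :> {poly F};
  monic_valP : monic_val \is monic }.

HB.instance Definition _ (F : finFieldType) := [isSub for @monic_val F].
HB.instance Definition _ (F : finFieldType) := [Choice of monic_poly F by <:].

Section Equivalence.
Variables (F : finFieldType) (l : nat).
Implicit Types f g h : monic_poly F.

Definition mequiv f g : bool :=
  [forall j : 'I_l.+1, (0 < j)%N ==> (top_coef f j == top_coef g j)].

Lemma mequivP f g :
  reflect (forall j, (1 <= j <= l)%N -> top_coef f j = top_coef g j)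
          (mequiv f g).
Proof.
apply: (iffP forallP) => [H j /andP[j0 jl]|H j].
  by have /implyP/(_ j0)/eqP := H (Ordinal (jl : (j < l.+1)%N)).
by apply/implyP => j0; apply/eqP/H; rewrite j0 -ltnS ltn_ord.
Qed.

Lemma mequiv_refl : reflexive mequiv.
Proof. by move=> f; apply/mequivP. Qed.

Lemma mequiv_sym : symmetric mequiv.
Proof. by move=> f g; apply/mequivP/mequivP => H j jl; rewrite H. Qed.

Lemma mequiv_trans : transitive mequiv.
Proof.
by move=> g f h /mequivP fg /mequivP gh; apply/mequivP => j jl; rewrite fg ?gh.
Qed.

Canonical mequiv_equiv := EquivRel mequiv mequiv_refl mequiv_sym mequiv_trans.

Definition mclass := {eq_quot mequiv}.
HB.instance Definition _ := EqQuotient.on mclass.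
HB.instance Definition _ := Choice.on mclass.

Definition class_of f : mclass := \pi f.

Lemma class_ofP f g :
  (class_of f = class_of g) <->
  (forall j, (1 <= j <= l)%N -> top_coef f j = top_coef g j).
Proof.
split=> [/eqmodP/mequivP //|H]; apply/eqmodP; exact/mequivP.
Qed.

Definition mrepr (c : mclass) : monic_poly F := generic_quotient.repr c.

Lemma repr_class (c : mclass) : class_of (mrepr c) = c.
Proof. exact: reprK. Qed.

Lemma size_monic_poly f : size f = (size f).-1.+1.
Proof. by rewrite prednK // size_poly_gt0 monic_neq0 // monic_valP. Qed.

Lemma top_coef0 f : top_coef f 0 = 1.
Proof. by rewrite /top_coef subn0 -lead_coefE (eqP (monic_valP f)). Qed.

Definition monic_mul f g : monic_poly F :=
  MonicPoly (rpredM (monic_valP f) (monic_valP g)).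
Definition monic_one : monic_poly F := MonicPoly (monic1 F).

Let polyrev d (p : {poly F}) := \sum_(i < d.+1) p`_i *: 'X^(d - i) : {poly F}.

Let coef_rev d p j : (polyrev d p)`_j = if (j <= d)%N then p`_(d - j) else 0.
Proof.
rewrite coef_sum; case: leqP => jd.
  rewrite (bigD1 (inord (d - j))) //= inordK ?ltnS ?leq_subr //.
  rewrite subKn // coefZ coefXn eqxx mulr1 big1 ?addr0 // => i ij.
  rewrite coefZ coefXn; case: eqP => [ji|]; last by rewrite mulr0.
  case/eqP: ij; apply: val_inj; rewrite /= inordK ?ltnS ?leq_subr //.
  by rewrite ji subKn // -ltnS.
apply: big1 => i _; rewrite coefZ coefXn; case: eqP => [ji|]; last by rewrite mulr0.
by move: jd; rewrite ji ltnNge leq_subr.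
Qed.

Let rev_sum d (I : finType) (P : I -> {poly F}) :
  polyrev d (\sum_i P i) = \sum_i polyrev d (P i).
Proof.
rewrite /polyrev exchange_big /=; apply: eq_bigr => i _.
by rewrite coef_sum scaler_suml.
Qed.

Let revZXn d c i : (i <= d)%N -> polyrev d (c *: 'X^i) = c *: 'X^(d - i).
Proof.
move=> id; apply/polyP => j; rewrite coef_rev !coefZ !coefXn.
case: leqP => jd; first by congr (c * _%:R); apply/eqP/eqP; lia.
by case: eqP => [ji|]; rewrite ?mulr0 //; move: jd; rewrite ji ltnNge leq_subr.
Qed.

Let revM a b (p q : {poly F}) : (size p <= a.+1)%N -> (size q <= b.+1)%N ->
  polyrev (a + b) (p * q) = polyrev a p * polyrev b q.
Proof.
move=> sp sq.
have E d (r : {poly F}) : (size r <= d.+1)%N -> r = \sum_(i < d.+1) r`_i *: 'X^i.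
  by move=> sr; rewrite -poly_def; apply/polyP => i; rewrite coef_poly;
     case: ltnP => // /(leq_trans sr) /leq_sizeP ->.
rewrite {1}(E _ _ sp) {1}(E _ _ sq) mulr_suml rev_sum {2}/polyrev mulr_suml.
apply: eq_bigr => i _; rewrite mulr_sumr rev_sum mulr_sumr; apply: eq_bigr => j _.
rewrite -!scalerAl -!scalerAr !scalerA -!exprD revZXn; last first.
  by rewrite leq_add // -ltnS.
congr (_ *: 'X^_); have := ltn_ord i; have := ltn_ord j; lia.
Qed.

Lemma top_coefM f g j : top_coef (monic_mul f g) j =
  \sum_(i < j.+1) top_coef f i * top_coef g (j - i).
Proof.
have E (h : {poly F}) i : top_coef h i = (polyrev (size h).-1 h)`_i by rewrite coef_rev.
have -> : top_coef (monic_mul f g) j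
        = (polyrev ((size f).-1 + (size g).-1) ((f : {poly F}) * g))`_j.
  rewrite E /= size_monicM ?monic_valP ?monic_neq0 ?monic_valP //.
  by rewrite size_monic_poly (size_monic_poly g) /= addnS.
rewrite revM -?size_monic_poly // coefM.
by apply: eq_bigr => i _; rewrite !E.
Qed.

Lemma class_of_mul f f' g g' :
  class_of f = class_of f' -> class_of g = class_of g' ->
  class_of (monic_mul f g) = class_of (monic_mul f' g').
Proof.
have T h h' : class_of h = class_of h' ->
    forall j, (j <= l)%N -> top_coef h j = top_coef h' j.
  by move=> /class_ofP H [|j] jl; [rewrite !top_coef0|exact: H].
move=> /T ff /T gg; apply/class_ofP => j /andP[_ jl].
rewrite !top_coefM; apply: eq_bigr => -[i ij] _ /=; rewrite ff ?gg //; lia.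
Qed.

(* This is <f><g> = <fg> on chosen representatives: see class_ofM. *)
Definition mclass_mul (a b : mclass) : mclass :=
  class_of (monic_mul (mrepr a) (mrepr b)).
Definition mclass_one : mclass := class_of monic_one.

Let mclass_mulE f g :
  mclass_mul (class_of f) (class_of g) = class_of (monic_mul f g).
Proof. by apply: class_of_mul; rewrite repr_class. Qed.

Let mclass_mulC : commutative mclass_mul.
Proof.
move=> a b; rewrite /mclass_mul; congr class_of.
by apply: val_inj; rewrite /= mulrC.
Qed.

Let mclass_mulA : associative mclass_mul.
Proof.
move=> a b c; rewrite -[a]repr_class -[b]repr_class -[c]repr_class !mclass_mulE.
by congr class_of; apply: val_inj; rewrite /= mulrA.
Qed.

Let mclass_mul1 : left_id mclass_one mclass_mul.
Proof.
move=> a; rewrite -[a]repr_class mclass_mulE.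
by congr class_of; apply: val_inj; rewrite /= mul1r.
Qed.

Let mclass_mulI a : injective (mclass_mul^~ a).
Proof.
move=> b c; rewrite -[a]repr_class -[b]repr_class -[c]repr_class !mclass_mulE.
move: (mrepr a) (mrepr b) (mrepr c) => f g h /class_ofP H; apply/class_ofP.
suff K j : (j <= l)%N -> top_coef g j = top_coef h j by move=> j /andP[_ /K].
elim/ltn_ind: j => -[_ _|j IH jl]; first by rewrite !top_coef0.
have := H j.+1; rewrite !top_coefM jl => /(_ isT).
rewrite [LHS]big_ord_recr [RHS]big_ord_recr /= subnn top_coef0 !mulr1.
rewrite (eq_bigr (fun i : 'I_j.+1 => top_coef h i * top_coef f (j.+1 - i))).
  by move=> /addrI.
by move=> i _; rewrite IH //; have := ltn_ord i; lia.
Qed.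

Let code (c : mclass) : {ffun 'I_l -> F} :=
  [ffun j : 'I_l => top_coef (mrepr c) j.+1].

Let decode_poly (v : {ffun 'I_l -> F}) : {poly F} :=
  'X^l + \poly_(i < l) (if insub (l - i).-1 is Some j then v j else 0).

Let decode_size v : size (decode_poly v) = l.+1.
Proof. by rewrite size_polyDl size_polyXn // ltnS size_poly. Qed.

Let decode_monic v : decode_poly v \is monic.
Proof.
by rewrite monicE lead_coefDl ?lead_coefXn // size_polyXn ltnS size_poly.
Qed.

Let decode v : mclass := class_of (MonicPoly (decode_monic v)).

Let decode_top v (j : 'I_l) : top_coef (decode_poly v) j.+1 = v j.
Proof.
have jl := ltn_ord j.
rewrite /top_coef decode_size /= jl /decode_poly coefD coefXn coef_poly.
have -> : (l - j.+1 == l)%N = false by apply/eqP; lia.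
have -> : (l - j.+1 < l)%N by lia.
have -> : ((l - (l - j.+1)).-1 = j)%N by lia.
by rewrite add0r valK.
Qed.

Let codeK : cancel code decode.
Proof.
move=> c; rewrite -[RHS]repr_class; apply/class_ofP => -[|j] // jl.
by rewrite (decode_top _ (Ordinal (jl : (j < l)%N))) ffunE.
Qed.

Let decodeK : cancel decode code.
Proof.
move=> v; apply/ffunP => j; rewrite ffunE -(decode_top v j).
have /class_ofP H := repr_class (decode v).
by rewrite H //= ltn_ord.
Qed.

HB.instance Definition _ : isCountable mclass := CanIsCountable codeK.
HB.instance Definition _ : isFinite mclass := CanIsFinite codeK.

Definition mclass_inv (a : mclass) : mclass := invF (@mclass_mulI a) mclass_one.

Let mclass_mulV : left_inverse mclass_one mclass_inv mclass_mul.
Proof. by move=> a; rewrite /mclass_inv (f_invF (@mclass_mulI a)). Qed.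

HB.instance Definition _ :=
  Finite_isGroup.Build mclass mclass_mulA mclass_mul1 mclass_mulV.

Lemma class_ofM f g : class_of (monic_mul f g) = (class_of f * class_of g)%g.
Proof. by rewrite -mclass_mulE. Qed.

Lemma mclass_mulgC (a b : mclass) : (a * b = b * a)%g.
Proof. exact: mclass_mulC. Qed.

Lemma card_mclass : #|{: mclass}| = (#|F| ^ l)%N.
Proof. by rewrite (bij_eq_card (Bijective codeK decodeK)) card_ffun card_ord. Qed.

End Equivalence.

Definition linear_monic (F : finFieldType) (a : F) : monic_poly F :=
  MonicPoly (monicXsubC a).

Definition degree_classes (F : finFieldType) (l i : nat) : {set mclass F l} :=
  [set c | `[< exists h : monic_poly F, size h = i.+1 /\ class_of l h = c >]].

(* W_j(eps), used only for k + 1 <= j <= k + l: beyond k + l the subtraction is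
   truncated, and below k + 1 the degree exceeds l - 1. *)
Definition W_count (F : finFieldType) (D : {set F}) (k l j : nat)
    (eps : mclass F l) : nat :=
  #|[set p : mclass F l * {set F} |
      [&& p.1 \in degree_classes F l (k + l - j),
          p.2 \subset D,
          #|p.2| == j &
          (p.1 * \prod_(a in p.2) class_of l (linear_monic a) == eps)%g]]|.

(* Words are indexed by the points of D instead of by 0, ..., #|D| - 1. *)
Definition word (F : finFieldType) (D : {set F}) : predArgType :=
  {ffun {x : F | x \in D} -> F}.
HB.instance Definition _ (F : finFieldType) (D : {set F}) :=
  Finite.on (word D).

Definition eval_word (F : finFieldType) (D : {set F}) (p : {poly F}) : word D :=
  [ffun x => p.[val x]].

(* {poly_k F} is the type of polynomials of size at most k, i.e., of degree at
   most k - 1, including 0. *)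
Definition RS_code (F : finFieldType) (D : {set F}) (k : nat) : {set word D} :=
  [set eval_word D g | g : {poly_k F}].

Definition hamming (F : finFieldType) (D : {set F}) (u v : word D) : nat :=
  #|[set x | u x != v x]|.

Definition uniform_expectation (T : finType) (A : {set T}) (X : T -> rat) : rat :=
  (\sum_(w in A) X w) / #|A|%:R.

(* Main.v *)
Require Import Defs.
From HB Require Import structures.
From mathcomp Require Import all_boot all_order all_fingroup all_algebra.
From mathcomp Require Import boolp zify.

Set Implicit Arguments.
Unset Strict Implicit.
Unset Printing Implicit Defensive.

Import GRing.Theory Num.Theory.
Local Open Scope ring_scope.

(* The quantity Y^(m falling) is m! times the number of m-element subsets S of
   D on which the codeword agrees with f, so its expectation is
   q^-k m! sum_S N(S), where N(S) counts the polynomials p of degree < k with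
   P_S | f - p, for P_S = prod_(a in S) (x - a).  If m <= k, these p are the
   f mod P_S + r P_S with deg r < k - m, whence N(S) = q^(k - m).  If m > k,
   then N(S) <= 1, and N(S) = 1 iff some monic multiple h P_S of degree k + l
   differs from f by a polynomial of degree < k, i.e. <h><P_S> = <f>; as <h> is
   determined by S in the group of classes, sum_S N(S) = W_m. *)

Section Interpolants.
Variables (F : finFieldType) (k : nat).
Implicit Types (S D : {set F}) (f p : {poly F}).

Definition vanishing_poly S : {poly F} := \prod_(a in S) ('X - a%:P).

Definition agreement f p : {set F} := [set a | f.[a] == p.[a]].

Definition interpolants f S : {set {poly_k F}} :=
  [set p : {poly_k F} | S \subset agreement f p].

Lemma vanishing_poly_monic S : vanishing_poly S \is monic.
Proof. exact: monic_prod_XsubC. Qed.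

Lemma size_vanishing_poly S : size (vanishing_poly S) = #|S|.+1.
Proof. by rewrite /vanishing_poly -big_enum size_prod_XsubC -cardE. Qed.

Lemma dvd_vanishing_poly S f p :
  (vanishing_poly S %| f - p) = (S \subset agreement f p).
Proof.
apply/idP/subsetP => [dvd a aS|sub].
  have r : root (f - p) a.
    apply: (root_dvdp dvd).
    by rewrite /vanishing_poly -big_enum root_prod_XsubC mem_enum.
  by rewrite inE -subr_eq0 -hornerN -hornerD.
rewrite /vanishing_poly -big_enum uniq_roots_dvdp //.
  apply/allP => a; rewrite mem_enum => /sub.
  by rewrite inE -subr_eq0 -hornerN -hornerD.
by rewrite uniq_rootsE enum_uniq.
Qed.

Lemma in_interpolants f S (p : {poly_k F}) :
  (p \in interpolants f S) = (vanishing_poly S %| f - (p : {poly F})).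
Proof. by rewrite inE dvd_vanishing_poly. Qed.

Lemma card_interpolants_small f S :
  (#|S| <= k)%N -> #|interpolants f S| = (#|F| ^ (k - #|S|))%N.
Proof.
move=> Sk; set P := vanishing_poly S.
have Pmon : P \is monic := vanishing_poly_monic S.
have P0 : P != 0 by rewrite monic_neq0.
have szP : size P = #|S|.+1 := size_vanishing_poly S.
have szr : (size (f %% P)%R <= #|S|)%N by rewrite -ltnS -szP ltn_modp.
pose lift (r : {poly_(k - #|S|) F}) : {poly_k F} :=
  npolyp k ((r : {poly F}) * P + f %% P).
(* [npolyp k] is faithful only on polynomials of size at most [k]; [#|S| <= k] ensures this for both
   summands. *)
have liftE r : lift r = (r : {poly F}) * P + f %% P :> {poly F}.
  apply: npolypK; rewrite (leq_trans (size_polyD _ _)) // geq_max.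
  rewrite (leq_trans szr) // andbT (leq_trans (size_polyMleq _ _)) // szP.
  by have := size_npoly r; lia.
have lift_inj : injective lift.
  move=> r s /(congr1 (@polyn F k)); rewrite !liftE => /addIr/(mulIf P0).
  exact: val_inj.
rewrite -card_npoly -(card_imset _ lift_inj); apply: eq_card => p.
rewrite in_interpolants -/P; apply/idP/imsetP => [dvd|[r _ ->]]; last first.
  rewrite liftE {1}(divp_eq f P) opprD addrACA subrr addr0 -mulrBl.
  exact: dvdp_mull.
(* The preimage of [p] is its quotient by [P]: since [P] divides [f - p], the remainder of [p] is
   already that of [f]. *)
have szq : (size ((p : {poly F}) %/ P)%R <= k - #|S|)%N.
  by rewrite size_divp // szP /= leq_sub2r ?size_npoly.
exists (npolyp _ ((p : {poly F}) %/ P)) => //; apply: val_inj.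
rewrite [RHS](liftE _) npolypK // [LHS](divp_eq p P); congr (_ + _).
by apply/esym/eqP; rewrite -subr_eq0 -modpN -modpD modp_eq0.
Qed.

(** Two interpolants differ by a multiple of [vanishing_poly S], whose degree [#|S| >= k] exceeds
    that of any nonzero difference. *)
Lemma card_interpolants_large f S :
  (k <= #|S|)%N -> (#|interpolants f S| <= 1)%N.
Proof.
move=> kS; apply/card_le1_eqP => r p.
rewrite !in_interpolants => dr dp; apply: val_inj; apply/eqP; rewrite -subr_eq0.
have d : vanishing_poly S %| val p - val r.
  have -> : val p - val r = (f - val r) - (f - val p).
    by rewrite opprB [RHS]addrC addrA subrK.
  exact: dvdp_sub.
apply: contraTT d => ne0; rewrite gtNdvdp // size_vanishing_poly ltnS.
rewrite (leq_trans _ kS) // (leq_trans (size_polyD _ _)) //.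
by rewrite size_polyN geq_max !size_npoly.
Qed.

(** Subtracting [p] of degree below [k] leaves the degree of [f] unchanged, so [f - p] is nonzero of
    degree less than [#|S|], too small for a multiple of [vanishing_poly S]. *)
Lemma interpolants_eq0 f S :
  (k < size f)%N -> (size f <= #|S|)%N -> interpolants f S = set0.
Proof.
move=> kf fS; apply/setP => p; rewrite in_interpolants inE.
have sz : size (f - val p) = size f.
  by rewrite size_polyDl // size_polyN (leq_ltn_trans (size_npoly p)).
apply/negP => /dvdp_leq; rewrite -size_poly_gt0 sz size_vanishing_poly.
by move=> /(_ (leq_ltn_trans (leq0n k) kf)); rewrite ltnNge fS.
Qed.

(** Double counting of the pairs [(p, S)] with [S] an [m]-subset of [D :&: agreement f p], after
    writing the falling factorial as a binomial times [m!]. *)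
Lemma sum_ffact_agreement f D m :
  (\sum_(p : {poly_k F}) #|D :&: agreement f p| ^_ m =
   m`! * \sum_(S : {set F} | (S \subset D) && (#|S| == m)) #|interpolants f S|)%N.
Proof.
rewrite mulnC; under eq_bigr do rewrite -bin_ffact.
rewrite -big_distrl /=; congr (_ * _)%N.
under eq_bigr => p _ do rewrite -cards_draws -sum1_card.
under [RHS]eq_bigr => S _ do rewrite -sum1_card.
rewrite (exchange_big_dep (fun S : {set F} => (S \subset D) && (#|S| == m))) /=.
  apply: eq_bigr => S /andP[SD Sm]; apply: eq_bigl => p.
  by rewrite !inE subsetI SD Sm andbT.
by move=> p S _; rewrite !inE subsetI => /andP[/andP[-> _] ->].
Qed.

End Interpolants.

Section Classes.
Variables (F : finFieldType) (k l : nat).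
Implicit Types (S : {set F}) (f g h : monic_poly F).

Definition vanishing_monic S : monic_poly F :=
  MonicPoly (vanishing_poly_monic S).

Lemma class_of_vanishing S :
  class_of l (vanishing_monic S) =
  (\prod_(a in S) class_of l (linear_monic a))%g.
Proof.
(* The relation carries a monicity proof along with each partial product, so that its class makes
   sense during the induction. *)
pose K (p : {poly F}) (c : mclass F l) :=
  exists pm : p \is monic, class_of l (MonicPoly pm) = c.
suff [pm <-] : K (vanishing_poly S) (\prod_(a in S) class_of l (linear_monic a))%g.
  by congr class_of; apply: val_inj.
rewrite /vanishing_poly; apply: (big_ind2 K).
- by exists (monic1 F); congr class_of; apply: val_inj.
- move=> p c p' c' [pm <-] [pm' <-]; exists (rpredM pm pm').
  by rewrite -class_ofM; congr class_of; apply: val_inj.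
by move=> a _; exists (monicXsubC a); congr class_of; apply: val_inj.
Qed.

(** The leading terms cancel, and the class records exactly the next [l] coefficients, those of
    exponents [k] to [k + l - 1]; only exponents below [k] remain free. *)
Lemma class_of_eq_size f g :
  size f = (k + l).+1 -> size g = (k + l).+1 ->
  (class_of l f = class_of l g) <->
  (size ((f : {poly F}) - (g : {poly F}))%R <= k)%N.
Proof.
move=> sf sg; split=> [/class_ofP H|/leq_sizeP H].
  apply/leq_sizeP => i ki; rewrite coefB.
  have [li|il] := ltnP (k + l) i; first by rewrite !nth_default ?subr0 ?sf ?sg.
  have [ei|ni] := eqVneq i (k + l)%N.
    have := monic_valP f; have := monic_valP g; rewrite !monicE !lead_coefE sf sg.
    by rewrite ei => /eqP -> /eqP ->; rewrite subrr.
  have := H (k + l - i)%N; rewrite /top_coef sf sg /= leq_subr subKn //.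
  by move=> ->; rewrite ?subrr //; lia.
apply/class_ofP => j jl; rewrite /top_coef sf sg /=; case: leqP => // jkl.
by apply/eqP; rewrite -subr_eq0 -coefB H //; lia.
Qed.

Lemma interpolants_gt0 f S :
  size f = (k + l).+1 -> (#|S| <= k + l)%N ->
  (0 < #|interpolants k f S|)%N =
  [exists c : mclass F l, (c \in degree_classes F l (k + l - #|S|)) &&
     (c * \prod_(a in S) class_of l (linear_monic a) == class_of l f)%g].
Proof.
move=> sf Sm.
have szM h : size h = (k + l - #|S|).+1 ->
    size (monic_mul h (vanishing_monic S)) = (k + l).+1.
  move=> sh; rewrite /= size_monicM ?monic_valP ?monic_neq0 ?vanishing_poly_monic //.
  rewrite size_vanishing_poly sh; lia.
apply/card_gt0P/existsP => [[p]|[c /andP[]]].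
  rewrite in_interpolants => /dvdpP[h Eh].
  have sfp : size ((f : {poly F}) - val p) = (k + l).+1.
    rewrite size_polyDl // size_polyN sf ltnS (leq_trans (size_npoly p)) //.
    exact: leq_addr.
  (* As [p] has degree below [k], [f - p = h * vanishing_poly S] keeps the leading coefficient 1 of
     [f]. *)
  have hm : h \is monic.
    rewrite -(monicMr _ (vanishing_poly_monic S)) -Eh monicE lead_coefDl.
      exact: monic_valP.
    by rewrite size_polyN sf ltnS (leq_trans (size_npoly p)) // leq_addr.
  have sh : size h = (k + l - #|S|).+1.
    move: sfp; rewrite Eh size_Mmonic ?monic_neq0 ?vanishing_poly_monic //.
    rewrite size_vanishing_poly; move: (size h) #|S| Sm => a b; lia.
  exists (class_of l (MonicPoly hm)); apply/andP; split.
    by rewrite inE; apply/asboolP; exists (MonicPoly hm).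
  rewrite -class_of_vanishing -class_ofM; apply/eqP.
  apply/class_of_eq_size => //; first exact: szM.
  by rewrite /= -Eh addrAC subrr sub0r size_polyN.
rewrite inE => /asboolP[h [sh <-]].
rewrite -class_of_vanishing -class_ofM eq_sym => /eqP.
move=> /(class_of_eq_size sf (szM _ sh)) sz.
(* The difference of [f] and the multiple of [vanishing_poly S] has size at most [k] by [sz], so it
   is itself an interpolant. *)
exists (npolyp k ((f : {poly F}) - (monic_mul h (vanishing_monic S) : {poly F}))).
by rewrite in_interpolants npolypK // opprB addrC subrK dvdp_mull.
Qed.

Lemma W_countE f (D : {set F}) m :
  size f = (k + l).+1 -> (k <= m <= k + l)%N ->
  W_count D k m (class_of l f) =
  (\sum_(S : {set F} | (S \subset D) && (#|S| == m)) #|interpolants k f S|)%N.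
Proof.
move=> sf /andP[km mkl]; rewrite /W_count.
set W := [set _ | _].
(* Cancellation in the group of classes: [S] and the product determine the first component. *)
have Winj : {in W &, injective (@snd (mclass F l) {set F})}.
  move=> [c S] [c' S']; rewrite !inE /= => /and4P[_ _ _ /eqP E].
  by move=> /and4P[_ _ _ /eqP E'] SS; move: E; rewrite SS -E' => /mulIg ->.
rewrite -(card_in_imset Winj) -sum1_card.
(* The sets with an interpolant form the image of [W], and each contributes exactly 1 because
   [k <= m]; the others contribute 0. *)
rewrite [RHS](bigID (fun S => 0 < #|interpolants k f S|)%N) /=.
rewrite [X in (_ + X)%N]big1 ?addn0.
  apply: eq_big => [S|S]; last first.
    case/imsetP=> -[c S'] + ->; rewrite inE /= => /and4P[cE S'D /eqP S'm E].
    apply/eqP; rewrite eqn_leq card_interpolants_large ?S'm // andbT.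
    rewrite interpolants_gt0 ?S'm //; apply/existsP; exists c.
    by rewrite cE.
  apply/imsetP/andP => [[[c S'] + ->]|[/andP[SD /eqP Sm]]].
    rewrite inE /= => /and4P[cE S'D /eqP S'm E].
    rewrite S'D S'm eqxx; split=> //.
    by rewrite interpolants_gt0 ?S'm //; apply/existsP; exists c; rewrite cE.
  rewrite interpolants_gt0 ?Sm // => /existsP[c /andP[cE E]].
  by exists (c, S) => //; rewrite inE /= cE SD Sm eqxx.
by move=> S /andP[_]; rewrite -eqn0Ngt => /eqP.
Qed.

End Classes.

Section Words.
Variables (F : finFieldType) (D : {set F}).

(** If [p] and [r] give the same word, both interpolate [r] on [D], which has at least [k]
    points. *)
Lemma eval_word_inj k : (k <= #|D|)%N ->
  injective (fun p : {poly_k F} => eval_word D p).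
Proof.
move=> kD p r pr.
suff sub : D \subset agreement r p.
  have /card_le1_eqP/(_ r p) := card_interpolants_large r kD.
  by apply; rewrite inE //; apply/subsetP => a _; rewrite inE.
apply/subsetP => a aD; rewrite inE.
by have /ffunP/(_ (Sub a aD)) := pr; rewrite !ffunE /= => ->.
Qed.

Lemma hamming_eval (f p : {poly F}) :
  (#|D| - hamming (eval_word D f) (eval_word D p))%N = #|D :&: agreement f p|.
Proof.
have -> : hamming (eval_word D f) (eval_word D p) = #|D :\: agreement f p|.
  rewrite /hamming -(card_imset _ val_inj); apply: eq_card => a.
  apply/imsetP/idP => [[x + ->]|].
    by rewrite !inE !ffunE => ->; rewrite (valP x).
  rewrite !inE => /andP[ne aD]; exists (Sub a aD) => //.
  by rewrite inE !ffunE.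
by rewrite cardsD subKn // subset_leq_card // subsetIl.
Qed.

End Words.

Theorem theorem5 (F : finFieldType) (D : {set F}) (n k l : nat)
    (hD : #|D| = n) (hk : (1 <= k <= n)%N) (hl : (1 <= l)%N)
    (hkl : (k + l <= n - 1)%N)
    (f : monic_poly F) (hf : size f = (k + l).+1) (m : nat) :
  let q : rat := #|F|%:R in
  let Z (g : word D) : nat := hamming (eval_word D f) g in
  let Y (g : word D) : nat := (n - Z g)%N in
  uniform_expectation (RS_code D k) (fun g => (Y g ^_ m)%:R)
  = (m <= k)%N%:R * (n ^_ m)%:R * q ^- m
    + (k + 1 <= m <= k + l)%N%:R
        * (q ^- k * m`!%:R * (W_count D k m (class_of l f))%:R).
Proof.
move=> q Z Y; rewrite -{}hD in hk hkl Y *; case/andP: hk => _ kn.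
have q0 : q != 0 by rewrite pnatr_eq0 -lt0n; apply/card_gt0P; exists 0.
have evI := eval_word_inj kn.
have cardRS : #|RS_code D k|%:R = q ^+ k.
  by rewrite /RS_code card_imset // card_npoly natrX.
(* Injectivity of evaluation turns the sum over codewords into one over polynomials, where the
   double count applies. *)
have sumE : \sum_(g in RS_code D k) (Y g ^_ m)%:R = (m`! *
    \sum_(S : {set F} | (S \subset D) && (#|S| == m)) #|interpolants k f S|)%:R
    :> rat.
  rewrite /RS_code big_imset /=; last by move=> p r _ _; apply: evI.
  rewrite -sum_ffact_agreement natr_sum; apply: eq_bigr => p _.
  by rewrite /Y /Z hamming_eval.
rewrite /uniform_expectation cardRS {}sumE addn1.
have [mk|km] := leqP m k.
  rewrite /= mul0r addr0 mul1r.
  (* Each of the ['C(n, m)] sets contributes [q^(k - m)], and [m! * 'C(n, m)] is the falling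
     factorial. *)
  rewrite (eq_bigr (fun=> #|F| ^ (k - m))%N); last first.
    by move=> S /andP[_ /eqP Sm]; rewrite card_interpolants_small Sm.
  rewrite sum_nat_const -cardsE cards_draws mulnA [(m`! * _)%N]mulnC bin_ffact.
  rewrite natrM natrX exprB ?unitfE // -mulrA; congr (_ * _).
  by rewrite mulrAC divff ?mul1r // expf_neq0.
rewrite !mul0r add0r /=; have [mkl|klm] := leqP m (k + l).
  by rewrite -(W_countE _ hf) ?(ltnW km) // mul1r natrM mulrC mulrA.
(* Here [m] exceeds the degree [k + l] of [f], so no set of size [m] has an interpolant. *)
rewrite mul0r big1 ?muln0 ?mul0r // => S /andP[_ /eqP Sm].
by rewrite interpolants_eq0 ?cards0 // hf ?Sm // ltnS leq_addr.
Qed.
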